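(* Let $m\geq 0$ be an integer. Let the premiums $\{X_n, n\geq 1\}$ and the claims $\{Y_n, n\geq 1\}$ be sequences of nonnegative, identically distributed, $m$-dependent random variables with finite expectations, and let the rates of interest $\{I_n, n\geq 1\}$ be a sequence of i.i.d. nonnegative random variables with finite expectations. Suppose that the sequences $\{X_n\}$, $\{Y_n\}$, $\{I_n\}$ are mutually independent. For $u\geq 0$ define the surplus process by $U_0=u$ and $$U_n=(U_{n-1}+X_n)(1+I_n)-Y_n,\quad n\geq 1,$$ and the ultimate ruin probability $\Psi(u)=\mathbb{P}\big(\bigcup_{n=1}^\infty \{U_n<0\}\big)$. If there exists a positive real number $R$ satisfying $$\mathbb{E}\Big(e^{R\left(Y_1(1+I_1)^{-1}-X_1\right)}\Big)\leq 1,$$ then $$\Psi(u)\leq (m+1)e^{-R\frac{u}{m+1}}\quad\text{for all } u>\frac{(m+1)\ln(m+1)}{R}.$$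
   Context: A sequence of random variables $\{X_n, n\geq 1\}$ is called $m$-dependent (for a fixed nonnegative integer $m$) if the $\sigma$-algebras $\sigma\{X_1,\dots,X_n\}$ and $\sigma\{X_{n+k},X_{n+k+1},\dots\}$ are independent for all $k\geq m+1$ and all $n\geq 1$. In particular, $0$-dependence is independence. *)

(* Defs.v *)
From HB Require Import structures.
From mathcomp Require Import all_boot all_order all_algebra.
From mathcomp Require Import all_classical all_reals all_analysis.
Set Implicit Arguments. Unset Strict Implicit. Unset Printing Implicit Defensive.
Import Order.TTheory GRing.Theory Num.Theory.
Import numFieldNormedType.Exports.
Local Open Scope classical_set_scope.
Local Open Scope ring_scope.

Section Defs.
Context {d : measure_display} {T : measurableType d} {R : realType}.

Definition gen_sigma (Ix : set nat) (X : nat -> T -> R) : set (set T) :=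
  <<s setT, [set A | exists i, Ix i /\ exists B : set R,
                   measurable B /\ A = X i @^-1` B] >>.

Definition indep_sets (P : probability T R) (F G : set (set T)) : Prop :=
  forall A B, F A -> G B -> P (A `&` B) = (P A * P B)%E.

(* m-dependence (indices shifted: X 0 is X_1) *)
Definition m_dependent (P : probability T R) (m : nat) (X : nat -> T -> R) :=
  forall n k, (m.+1 <= k)%N ->
    indep_sets P (gen_sigma [set i | (i <= n)%N] X)
                 (gen_sigma [set i | (n + k <= i)%N] X).

Definition ident_distr (P : probability T R) (X : nat -> T -> R) :=
  forall n (B : set R), measurable B -> P (X n @^-1` B) = P (X 0%N @^-1` B).

(* mutual independence of the sequence: product rule over every finite
   initial segment (setT belongs to each sigma-algebra, so this covers every
   finite subfamily) *)
Definition mutually_indep (P : probability T R) (X : nat -> T -> R) :=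
  forall n (A : nat -> set T),
    (forall i, (i < n)%N -> gen_sigma [set i] X (A i)) ->
    P (\big[setI/setT]_(i < n) A i) = (\prod_(i < n) P (A i))%E.

Definition indep3 (P : probability T R) (X Y Z : nat -> T -> R) :=
  forall A B C, gen_sigma setT X A -> gen_sigma setT Y B ->
    gen_sigma setT Z C -> P (A `&` B `&` C) = (P A * P B * P C)%E.

(* surplus process: U 0 = u, U (n+1) = (U n + X_{n+1})(1 + I_{n+1}) - Y_{n+1};
   with shifted indices X n stands for X_{n+1}. *)
Fixpoint surplus (X Y I : nat -> T -> R) (u : R) (n : nat) (t : T) : R :=
  match n with
  | 0%N => u
  | n'.+1 => (surplus X Y I u n' t + X n' t) * (1 + I n' t) - Y n' t
  end.

Definition ruin_prob (P : probability T R) (X Y I : nat -> T -> R) (u : R) :=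
  P (\bigcup_n [set t | surplus X Y I u n.+1 t < 0]).

End Defs.

(* Main.v *)
Require Import Defs.
From HB Require Import structures.
From mathcomp Require Import all_boot all_order all_algebra.
From mathcomp Require Import all_classical all_reals all_analysis.
From mathcomp Require Import measurable_realfun ring lra zify.
Import Order.TTheory GRing.Theory Num.Theory.
Import numFieldNormedType.Exports.
Local Open Scope classical_set_scope.
Local Open Scope ring_scope.

(** Put Z_n = Y_n / (1 + I_n) - X_n and D_n = \prod_(j < n) (1 + I_j)^-1, so that
    the discounted surplus is U_n D_n = u - \sum_(i < n) D_i Z_i. Ruin forces one of
    the m + 1 partial sums over a residue class of i modulo m + 1 to exceed
    u / (m + 1). Within a class, Z_n is independent of everything that occurred
    before together with D_n, and since 0 <= D_n <= 1, convexity gives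
    exp(R D_n Z_n) <= 1 - D_n + D_n exp(R Z_n); hence the exponential of each class
    sum is a supermartingale, and the maximal inequality bounds the probability
    that the class sum ever exceeds u / (m + 1) by exp(- R u / (m + 1)). *)

(** * Independence of classes of events and the product formula for expectations *)

Section independence.
Context {d : measure_display} {T : measurableType d} {R : realType}.
Variable P : probability T R.
Implicit Types F G : set (set T).

Lemma indep_setsC F G : indep_sets P F G -> indep_sets P G F.
Proof. by move=> FG A B GA FB; rewrite setIC FG// muleC. Qed.

Lemma indep_setsS F F' G G' : F' `<=` F -> G' `<=` G ->
  indep_sets P F G -> indep_sets P F' G'.
Proof. by move=> FF GG FG A B /FF FA /GG GB; exact: FG. Qed.

Lemma g_sigma_algebra_sub F : F `<=` measurable -> <<s F >> `<=` measurable.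
Proof. by move=> Fm; apply: smallest_sub => //; exact: sigma_algebra_measurable. Qed.

Lemma g_sigma_algebraT F : <<s F >> setT.
Proof. exact: (@measurableT _ (g_sigma_algebraType F)). Qed.

Lemma g_sigma_algebraI F : setI_closed <<s F >>.
Proof. by move=> A B FA FB; exact: (@measurableI _ (g_sigma_algebraType F)). Qed.

(** For fixed [B] in [G], restricting [P] to [B] and scaling [P] by [P B] give two finite measures
    that agree on the pi-system [F]; by uniqueness of measures they agree on [<<s F >>]. *)
Lemma indep_sets_sigmal F G : F `<=` measurable -> G `<=` measurable ->
  setI_closed F -> F setT -> indep_sets P F G -> indep_sets P <<s F >> G.
Proof.
move=> Fm Gm FI FT FG A B FA GB.
have mB : measurable B by exact: Gm.
have PBE : (fine (P B))%:E = P B by rewrite fineK// fin_num_measure.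
have PB0 : 0 <= fine (P B) by rewrite fine_ge0.
pose m1 := mrestr P mB.
pose m2 := mscale (NngNum PB0) P.
have -> : P (A `&` B) = m1 A by [].
have m2E C : m2 C = (P C * P B)%E by rewrite /m2 /mscale/= PBE muleC.
rewrite -m2E.
apply: (g_sigma_algebra_measure_unique F Fm (fun=> setT)) => //.
- by rewrite bigcup_const//; exists 0%N.
- by move=> C FC; rewrite [RHS]m2E -FG.
- move=> _; change (P (setT `&` B) < +oo)%E.
  by rewrite setTI ltey_eq fin_num_measure.
Qed.

Lemma indep_sets_sigma F G : F `<=` measurable -> G `<=` measurable ->
  setI_closed F -> F setT -> setI_closed G -> G setT ->
  indep_sets P F G -> indep_sets P <<s F >> <<s G >>.
Proof.
move=> Fm Gm FI FT GI GT FG.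
apply/indep_setsC/indep_sets_sigmal => //; first exact: g_sigma_algebra_sub.
exact/indep_setsC/indep_sets_sigmal.
Qed.

(** For three sigma-algebras these intersections form a pi-system generating their join, so
    independence of joins can be checked on them. *)
Definition setI3_class F1 F2 F3 : set (set T) :=
  [set E | exists A B C, [/\ F1 A, F2 B, F3 C & E = A `&` B `&` C]].

Lemma setI3_class_setI F1 F2 F3 :
  setI_closed F1 -> setI_closed F2 -> setI_closed F3 ->
  setI_closed (setI3_class F1 F2 F3).
Proof.
move=> I1 I2 I3 _ _ [A [B [C [FA FB FC ->]]]] [A' [B' [C' [FA' FB' FC' ->]]]].
exists (A `&` A'), (B `&` B'), (C `&` C'); split; [exact: I1|exact: I2|exact: I3|].
by rewrite setIACA (setIACA A).
Qed.

Lemma setI3_class_measurable F1 F2 F3 : F1 `<=` measurable ->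
  F2 `<=` measurable -> F3 `<=` measurable ->
  setI3_class F1 F2 F3 `<=` measurable.
Proof.
move=> m1 m2 m3 _ [A [B [C [/m1 ? /m2 ? /m3 ? ->]]]].
by apply: measurableI => //; exact: measurableI.
Qed.

Lemma setI3_class_sub1 F1 F2 F3 : F2 setT -> F3 setT ->
  F1 `<=` setI3_class F1 F2 F3.
Proof. by move=> F2T F3T A FA; exists A, setT, setT; rewrite !setIT. Qed.

Lemma setI3_class_sub2 F1 F2 F3 : F1 setT -> F3 setT ->
  F2 `<=` setI3_class F1 F2 F3.
Proof. by move=> F1T F3T A FA; exists setT, A, setT; rewrite setIT setTI. Qed.

Lemma setI3_class_sub3 F1 F2 F3 : F1 setT -> F2 setT ->
  F3 `<=` setI3_class F1 F2 F3.
Proof. by move=> F1T F2T A FA; exists setT, setT, A; rewrite !setTI. Qed.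

(** Here and below, retyping the domain as [g_sigma_algebraType F] expresses measurability with
    respect to the sub-sigma-algebra generated by [F]. *)
Lemma indep_sets_measurable_fun (d1 d2 : measure_display)
    (T1 : measurableType d1) (T2 : measurableType d2) F G
    (f : T -> T1) (g : T -> T2) :
  indep_sets P <<s F >> <<s G >> ->
  measurable_fun setT (f : g_sigma_algebraType F -> T1) ->
  measurable_fun setT (g : g_sigma_algebraType G -> T2) ->
  forall A B, measurable A -> measurable B ->
    P (f @^-1` A `&` g @^-1` B) = (P (f @^-1` A) * P (g @^-1` B))%E.
Proof.
move=> FG mf mg A B mA mB; apply: FG.
- by have := mf measurableT _ mA; rewrite setTI.
- by have := mg measurableT _ mB; rewrite setTI.
Qed.

Lemma measurable_fun_sub_sigma (d1 : measure_display) (T1 : measurableType d1)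
    F (f : T -> T1) : F `<=` measurable ->
  measurable_fun setT (f : g_sigma_algebraType F -> T1) -> measurable_fun setT f.
Proof.
move=> Fm mf _ B mB; apply: (g_sigma_algebra_sub F Fm).
exact: (mf measurableT B mB).
Qed.

Local Open Scope ereal_scope.

(** The product rule on rectangles identifies the joint law with the product of the marginal laws;
    Tonelli then gives the iterated integral. *)
Lemma ge0_integral_indep (d1 d2 : measure_display)
    (T1 : measurableType d1) (T2 : measurableType d2)
    (f : {RV P >-> T1}) (g : {RV P >-> T2}) (h : T1 * T2 -> \bar R) :
  (forall A B, measurable A -> measurable B ->
    P (f @^-1` A `&` g @^-1` B) = P (f @^-1` A) * P (g @^-1` B)) ->
  measurable_fun setT h -> (forall z, 0 <= h z) ->
  \int[P]_t h (f t, g t) =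
  \int[distribution P f]_x \int[distribution P g]_y h (x, y).
Proof.
move=> fg mh h0.
have mfg : measurable_fun setT (fun t => (f t, g t)).
  by apply: measurable_fun_pair.
pose fgm := isMeasurableFun.Build _ _ _ _ _ mfg.
pose fgp : {mfun _ >-> _} := HB.pack (fun t => (f t, g t)) fgm.
rewrite -(@ge0_integral_distribution _ _ _ _ _ P fgp)//.
rewrite -[RHS](@fubini_tonelli1 _ _ _ _ _ (distribution P f) (distribution P g) h mh h0).
apply: eq_measure_integral => A mA _; apply/esym.
by apply: product_measure_unique => // B C mB mC; rewrite -fg.
Qed.

Lemma ge0_expectationM_indep (f g : {RV P >-> R}) :
  (forall A B : set R, measurable A -> measurable B ->
    P (f @^-1` A `&` g @^-1` B) = P (f @^-1` A) * P (g @^-1` B)) ->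
  (forall t, (0 <= f t)%R) -> (forall t, (0 <= g t)%R) ->
  \int[P]_t (f t * g t)%:E = (\int[P]_t (f t)%:E) * (\int[P]_t (g t)%:E).
Proof.
move=> fg f0 g0.
(* The absolute value makes [h] nonnegative on the whole plane and changes nothing at
   [(f t, g t)]. *)
pose h (z : R * R) := `|z.1 * z.2|%:E.
have h0 z : 0 <= h z by rewrite lee_fin.
transitivity (\int[P]_t h (f t, g t)).
  by apply: eq_integral => t _; rewrite /h/= ger0_norm// mulr_ge0.
have mh : measurable_fun setT h.
  by apply/measurable_EFinP/measurableT_comp => //; exact: measurable_funM.
rewrite ge0_integral_indep//.
transitivity (\int[distribution P f]_x (`|x|%:E * \int[P]_t (g t)%:E)).
  apply: eq_integral => x _; rewrite ge0_integral_distribution//; last exact: (measurable_fun_pair2 x mh).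
  rewrite -ge0_integralZl//; last 2 first.
  - exact/measurable_EFinP.
  - by move=> t _; rewrite lee_fin.
  by apply: eq_integral => t _; rewrite /h/= normrM (ger0_norm (g0 t)) EFinM.
rewrite ge0_integralZr//; last 2 first.
- by apply/measurable_EFinP; exact: normr_measurable.
- by apply: integral_ge0 => t _; rewrite lee_fin.
congr (_ * _); rewrite ge0_integral_distribution//.
- by apply: eq_integral => t _ /=; rewrite ger0_norm.
- by apply/measurable_EFinP; exact: normr_measurable.
Qed.

End independence.

(** * Exponential supermartingales and their maximal inequality *)

Definition below {T : Type} {R : realType} (W : nat -> T -> R) (v : R) (n : nat) :
  set T := \bigcap_(j in [set j | (j <= n)%N]) [set t | W j t <= v].

Lemma belowS {T : Type} {R : realType} (W : nat -> T -> R) v n :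
  below W v n.+1 `<=` below W v n.
Proof. by move=> t h j jn; apply: h; exact: leqW. Qed.

Lemma measurable_sublevel (d : measure_display) (T : measurableType d)
    (R : realType) (f : T -> R) (v : R) :
  measurable_fun setT f -> measurable [set t | f t <= v].
Proof.
move=> mf; have := mf measurableT `]-oo, v]%classic (measurable_itv _).
by rewrite setTI; congr measurable; apply/seteqP; split => t /=; rewrite in_itv.
Qed.

Lemma measurable_below (d : measure_display) (T : measurableType d)
    (R : realType) (W : nat -> T -> R) v n :
  (forall j, (j <= n)%N -> measurable_fun setT (W j)) -> measurable (below W v n).
Proof.
move=> mW; apply: bigcap_measurable => [|j jn]; first by exists 0%N.
exact/measurable_sublevel/mW.
Qed.

Section supermartingale_bounds.
Context {d : measure_display} {T : measurableType d} {R : realType}.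
Variable P : probability T R.
Local Open Scope ereal_scope.

(** The tangent to [expR] at [y = a * x] lies below the graph at [0] and at [x]; averaging the two
    bounds with weights [1 - a] and [a] cancels the linear terms. *)
Lemma expR_convex01 (a x : R) : (0 <= a <= 1 ->
  expR (a * x) <= (1 - a) + a * expR x)%R.
Proof.
move=> /andP[a0 a1]; set y := (a * x)%R.
have e0 : (1 + (0 - y) <= expR (0 - y))%R by exact: expR_ge1Dx.
have e1 : (1 + (x - y) <= expR (x - y))%R by exact: expR_ge1Dx.
have -> : ((1 - a) + a * expR x =
    expR y * ((1 - a) * expR (0 - y) + a * expR (x - y)))%R.
  rewrite !expRB expR0; field; exact: lt0r_neq0 (expR_gt0 _).
rewrite -[leLHS]mulr1 ler_pM2l ?expR_gt0//.
have h0 : ((1 - a) * (1 + (0 - y)) <= (1 - a) * expR (0 - y))%R.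
  by rewrite ler_wpM2l// subr_ge0.
have h1 : (a * (1 + (x - y)) <= a * expR (x - y))%R by rewrite ler_wpM2l.
apply: le_trans (lerD h0 h1).
by rewrite /y; nra.
Qed.

Lemma ge0_integral_EFinD (f g : T -> R) :
  measurable_fun setT f -> measurable_fun setT g ->
  (forall t, (0 <= f t)%R) -> (forall t, (0 <= g t)%R) ->
  \int[P]_t (f t + g t)%:E = \int[P]_t (f t)%:E + \int[P]_t (g t)%:E.
Proof.
move=> mf mg f0 g0; under eq_integral do rewrite EFinD.
by rewrite ge0_integralD//; [move=> t _; rewrite lee_fin|exact/measurable_EFinP
  |move=> t _; rewrite lee_fin|exact/measurable_EFinP].
Qed.

Lemma ge0_integral_indepM {F G : set (set T)} {f g : T -> R} :
  F `<=` measurable -> G `<=` measurable ->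
  indep_sets P <<s F >> <<s G >> ->
  measurable_fun setT (f : g_sigma_algebraType F -> R) ->
  measurable_fun setT (g : g_sigma_algebraType G -> R) ->
  (forall t, (0 <= f t)%R) -> (forall t, (0 <= g t)%R) ->
  \int[P]_t (f t * g t)%:E = (\int[P]_t (f t)%:E) * (\int[P]_t (g t)%:E).
Proof.
move=> Fm Gm FG mf mg f0 g0.
have mfT : measurable_fun setT f by exact: measurable_fun_sub_sigma mf.
have mgT : measurable_fun setT g by exact: measurable_fun_sub_sigma mg.
pose fm := isMeasurableFun.Build _ _ _ _ _ mfT.
pose gm := isMeasurableFun.Build _ _ _ _ _ mgT.
pose f' : {RV P >-> R} := HB.pack f fm.
pose g' : {RV P >-> R} := HB.pack g gm.
apply: (ge0_expectationM_indep P f' g') => //.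
exact: (indep_sets_measurable_fun P _ _ _ _ F G).
Qed.

(** The supermartingale step, with conditional expectation replaced by testing against nonnegative
    past-measurable [g]. Convexity bounds the left side by E[g(1 - a)] + E[g a] E[exp z], the
    product coming from independence. *)
Lemma integral_expR_step {F G : set (set T)} {g a z : T -> R} :
  F `<=` measurable -> G `<=` measurable ->
  indep_sets P <<s F >> <<s G >> ->
  measurable_fun setT (g : g_sigma_algebraType F -> R) ->
  measurable_fun setT (a : g_sigma_algebraType F -> R) ->
  measurable_fun setT (z : g_sigma_algebraType G -> R) ->
  (forall t, (0 <= g t)%R) -> (forall t, (0 <= a t <= 1)%R) ->
  \int[P]_t (expR (z t))%:E <= 1 ->
  \int[P]_t (g t * expR (a t * z t))%:E <= \int[P]_t (g t)%:E.
Proof.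
move=> Fm Gm FG mg ma mz g0 a01 Ez.
have mgT : measurable_fun setT g by exact: measurable_fun_sub_sigma mg.
have maT : measurable_fun setT a by exact: measurable_fun_sub_sigma ma.
have mzT : measurable_fun setT z by exact: measurable_fun_sub_sigma mz.
have mezT : measurable_fun setT (fun t => expR (z t)) by exact: measurableT_comp.
have a0 t : (0 <= a t)%R by have /andP[] := a01 t.
have a1 t : (0 <= 1 - a t)%R by have /andP[_] := a01 t; rewrite subr_ge0.
have mga1 : measurable_fun setT (fun t => g t * (1 - a t))%R.
  by apply: measurable_funM => //; exact: measurable_funB.
have mga : measurable_fun setT (fun t => g t * a t)%R by exact: measurable_funM.
apply: (@le_trans _ _
  (\int[P]_t (g t * (1 - a t) + g t * a t * expR (z t))%:E)).
  apply: ge0_le_integral => //.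
  - by move=> t _; rewrite lee_fin mulr_ge0// expR_ge0.
  - apply/measurable_EFinP; apply: measurable_funM => //.
    by apply: measurableT_comp => //; exact: measurable_funM.
  - apply/measurable_EFinP; apply: measurable_funD => //.
    exact: measurable_funM.
  move=> t _; rewrite lee_fin -mulrA -mulrDr ler_wpM2l//.
  exact: expR_convex01.
rewrite ge0_integral_EFinD//; last 3 first.
- exact: measurable_funM.
- by move=> t; rewrite mulr_ge0.
- by move=> t; rewrite !mulr_ge0// expR_ge0.
rewrite (@ge0_integral_indepM F G (fun t => g t * a t)%R (fun t => expR (z t))
  Fm Gm FG)//; last 3 first.
- exact: measurable_funM.
- exact: measurableT_comp.
- by move=> t; rewrite mulr_ge0.
have -> : \int[P]_t (g t)%:E =
    \int[P]_t (g t * (1 - a t))%:E + \int[P]_t (g t * a t)%:E.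
  rewrite -ge0_integral_EFinD//; last 2 first.
  - by move=> t; rewrite mulr_ge0.
  - by move=> t; rewrite mulr_ge0.
  by apply: eq_integral => t _; congr (_%:E); ring.
rewrite leeD2l// -[leRHS]mule1 lee_wpmul2l//.
by apply: integral_ge0 => t _; rewrite lee_fin mulr_ge0.
Qed.

(** [M n] carries exp(c W_n) on paths still in [below W v n], and [K n] carries the constant exp(c
    v) on those that have left. The sum of their integrals starts at 1 at most and never increases.
    Dropping [M n] bounds the probability of having left by time [n], and continuity from below lets
    [n] tend to infinity. *)
Lemma maximal_inequality (W : nat -> T -> R) (c v : R) :
  (0 <= c)%R -> (0 <= v)%R -> (forall j, measurable_fun setT (W j)) ->
  (forall t, W 0%N t = 0%R) ->
  (forall n, \int[P]_t (\1_(below W v n) t * expR (c * W n.+1 t))%:E <=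
             \int[P]_t (\1_(below W v n) t * expR (c * W n t))%:E) ->
  P (\bigcup_n [set t | (v < W n t)%R]) <= (expR (- (c * v)))%:E.
Proof.
move=> c0 v0 mW W0 Wstep.
pose B := below W v.
have mB n : measurable (B n) by exact: measurable_below.
pose M n t := (\1_(B n) t * expR (c * W n t))%R.
pose K n t := (\1_(~` B n) t * expR (c * v))%R.
have mE n : measurable_fun setT (fun t => expR (c * W n t)).
  by apply: measurableT_comp => //; exact: measurable_funM.
have mM n : measurable_fun setT (M n).
  by apply: measurable_funM => //; exact: measurable_indic.
have mK n : measurable_fun setT (K n).
  by apply: measurable_funM => //; apply: measurable_indic; exact: measurableC.
have M0 n t : (0 <= M n t)%R by rewrite mulr_ge0// expR_ge0.
have K0 n t : (0 <= K n t)%R by rewrite mulr_ge0// expR_ge0.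
have MK n : \int[P]_t (M n t)%:E + \int[P]_t (K n t)%:E <= 1.
  elim: n => [|n IH].
    rewrite -ge0_integral_EFinD//.
    rewrite (eq_integral (cst 1)).
      by rewrite integral_cst// mul1e; exact: probability_le1.
    move=> t _; rewrite /M /K !indicE.
    have -> : B 0%N = setT.
      by apply/seteqP; split => // s _ j; rewrite /= leqn0 => /eqP->; rewrite W0.
    by rewrite setCT in_setT in_set0 mul0r addr0 mul1r W0 mulr0 expR0.
  apply: le_trans IH; apply: le_trans (leeD2r _ (Wstep n)).
  have mM' : measurable_fun setT (fun t => \1_(below W v n) t * expR (c * W n.+1 t))%R.
    by apply: measurable_funM => //; exact: measurable_indic.
  rewrite -!ge0_integral_EFinD//.
  apply: ge0_le_integral => //.
  - by move=> t _; rewrite lee_fin addr_ge0.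
  - by apply/measurable_EFinP; exact: measurable_funD.
  - by apply/measurable_EFinP; exact: measurable_funD.
  move=> t _; rewrite lee_fin /M /K -/B !indicE !in_setC.
  have [tS|tS] := boolP (t \in B n.+1).
    have -> : t \in B n by move: tS; rewrite !inE; exact: belowS.
    by rewrite /= !mul0r !addr0.
  have [tn|tn] := boolP (t \in B n); rewrite /= !(mul0r, mul1r, addr0, add0r)//.
  (* What remains are the paths that leave exactly at time [n.+1]: had they [W n.+1 t < v], they
     would still be in [B n.+1]. *)
  rewrite ler_expR ler_wpM2l// leNgt; apply/negP => Wv.
  move/negP: tS; apply; rewrite inE => j /=; rewrite leq_eqVlt => /predU1P[->|jn].
    exact: ltW.
  by move: tn; rewrite inE; apply.
have PB n : P (~` B n) <= (expR (- (c * v)))%:E.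
  have : \int[P]_t (K n t)%:E <= 1.
    by apply: le_trans (MK n); rewrite leeDr// integral_ge0// => t _; rewrite lee_fin.
  rewrite /K; under eq_integral do rewrite mulrC EFinM.
  rewrite ge0_integralZl//; last first.
    by apply/measurable_EFinP; apply: measurable_indic; exact: measurableC.
  rewrite integral_indic//; last exact: measurableC.
  by rewrite setIT expRN -lee_pdivlMl ?expR_gt0// mule1.
have sub : \bigcup_n [set t | (v < W n t)%R] `<=` \bigcup_n (~` B n).
  move=> t [n _ /= vW]; exists n => //= tB.
  by have := tB n (leqnn n); rewrite /= leNgt vW.
have mC n : measurable (~` B n) by exact: measurableC.
apply: (@le_trans _ _ (P (\bigcup_n (~` B n)))).
  apply: le_measure => //; rewrite inE; apply: bigcup_measurable => // n _.
  have -> : [set t | (v < W n t)%R] = ~` [set t | (W n t <= v)%R].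
    by apply/seteqP; split => t /=; rewrite ltNge => /negP.
  exact/measurableC/measurable_sublevel.
(* The sets [B n] decrease, so their complements increase to the union. *)
have /cvg_lim <- // : P \o (fun n => ~` B n) @ \oo --> P (\bigcup_n (~` B n)).
  apply: nondecreasing_cvg_mu => //; first exact: bigcup_measurable.
  apply/nondecreasing_seqP => n; apply/subsetPset/subsetC; exact: belowS.
apply: lime_le; last by apply: nearW => n; exact: PB.
apply/cvg_ex; eexists; apply: nondecreasing_cvg_mu => //; first exact: bigcup_measurable.
by apply/nondecreasing_seqP => n; apply/subsetPset/subsetC; exact: belowS.
Qed.

End supermartingale_bounds.

(** * Sigma-algebras generated by blocks of indices, and their independence *)

Section generated_sigma.
Context {d : measure_display} {T : measurableType d} {R : realType}.
Variable P : probability T R.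
Implicit Types (X Y Z : nat -> T -> R) (I J K : set nat).

Lemma gen_sigma_measurable X I :
  (forall i, measurable_fun setT (X i)) -> gen_sigma I X `<=` measurable.
Proof.
move=> mX; apply: g_sigma_algebra_sub => _ [i [_ [B [mB ->]]]].
by have := mX i measurableT _ mB; rewrite setTI.
Qed.

Lemma sub_gen_sigma X I J : I `<=` J -> gen_sigma I X `<=` gen_sigma J X.
Proof.
by move=> IJ; apply: sub_sigma_algebra2 => A [i [/IJ Ji iB]]; exists i.
Qed.

Lemma gen_sigma_preimage X I i (B : set R) :
  I i -> measurable B -> gen_sigma I X (X i @^-1` B).
Proof.
by move=> Ii mB; apply: sub_sigma_algebra; exists i; split => //; exists B.
Qed.

Lemma indep_sets_trivial G : G `<=` measurable -> indep_sets P [set set0; setT] G.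
Proof.
move=> Gm A B [->|->] /Gm mB; first by rewrite set0I measure0 mul0e.
by rewrite setTI probability_setT mul1e.
Qed.

Lemma gen_sigma_set0 X : gen_sigma set0 X `<=` [set set0; setT].
Proof.
apply: smallest_sub => [|A [i [//]]]; split => [|A [|] ->|F FT]; first by left.
- by right; rewrite setD0.
- by left; rewrite setDv.
have [[n Fn]|F0] := pselect (exists n, F n = setT).
  by right; apply/seteqP; split => // t _; exists n => //; rewrite Fn.
left; rewrite bigcup0// => n _; have [//|Fn] := FT n.
by exfalso; apply: F0; exists n.
Qed.

(** Covers empty blocks: pasts that are too short to contain an index, and coordinates deliberately
    left out of a joint block. *)
Lemma indep_sets_gen_sigma_set0 X Y J :
  (forall i, measurable_fun setT (Y i)) ->
  indep_sets P (gen_sigma set0 X) (gen_sigma J Y).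
Proof.
move=> mY.
apply: (indep_setsS P [set set0; setT] _ (gen_sigma J Y)) => //.
- exact: gen_sigma_set0.
- exact/indep_sets_trivial/gen_sigma_measurable.
Qed.

(** If [m < k], the past block ends at [k - m.+1], exactly [m.+1] steps before [k], the smallest gap
    that m-dependence allows; otherwise it is empty. *)
Lemma m_dependent_past X m k : (forall i, measurable_fun setT (X i)) ->
  m_dependent P m X ->
  indep_sets P (gen_sigma [set i | (i + m < k)%N] X) (gen_sigma [set k] X).
Proof.
move=> mX Xm; have [mk|km] := ltnP m k.
  apply: indep_setsS (Xm (k - m.+1)%N m.+1 (leqnn _)).
  - by apply: sub_gen_sigma => i /=; lia.
  - by apply: sub_gen_sigma => i /= ->; lia.
have -> : [set i | (i + m < k)%N] = set0.
  by apply/seteqP; split => i //=; lia.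
exact: indep_sets_gen_sigma_set0.
Qed.

(** The intersections of one event per index below [k] form a pi-system generating the past, so it
    suffices to separate them from an event at index [k]. *)
Lemma mutually_indep_past X k : (forall i, measurable_fun setT (X i)) ->
  mutually_indep P X ->
  indep_sets P (gen_sigma [set i | (i < k)%N] X) (gen_sigma [set k] X).
Proof.
move=> mX Xind.
pose F : set (set T) := [set E | exists A : nat -> set T,
  (forall i, (i < k)%N -> gen_sigma [set i] X (A i)) /\
  E = \big[setI/setT]_(i < k) A i].
have FT : F setT.
  exists (fun=> setT); split; last by rewrite big1.
  by move=> i _; exact: g_sigma_algebraT.
have Fm : F `<=` measurable.
  move=> _ [A [GA ->]]; apply: bigsetI_measurable => i _.
  by apply: (gen_sigma_measurable X [set nat_of_ord i]) => //; exact: GA.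
have FI : setI_closed F.
  move=> _ _ [A [GA ->]] [B [GB ->]]; exists (fun i => A i `&` B i); split.
    by move=> i ik; apply: g_sigma_algebraI; [exact: GA|exact: GB].
  by rewrite big_split.
apply: (indep_setsS P <<s F >> _ (gen_sigma [set k] X)) => //.
  apply: smallest_sub => [|_ [i [ik [B [mB ->]]]]]; first exact: smallest_sigma_algebra.
  apply: sub_sigma_algebra.
  exists (fun j => if j == i then X i @^-1` B else setT); split.
    move=> j _; case: eqP => [->|_]; last exact: g_sigma_algebraT.
    exact: gen_sigma_preimage.
  rewrite (bigD1 (Ordinal ik))//= eqxx big1 ?setIT//.
  by move=> j jk; rewrite ifN.
apply: indep_sets_sigmal => //; first exact: gen_sigma_measurable.
move=> _ C [A [GA ->]] GC.
(* Placing [C] at index [k] turns the claim into the product rule for [k.+1] events compared with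
   the rule for [k] events. *)
pose A' i := if (i < k)%N then A i else C.
have A'E : \big[setI/setT]_(i < k) A' i = \big[setI/setT]_(i < k) A i.
  by apply: eq_bigr => i _; rewrite /A' ltn_ord.
have := Xind k.+1 A'; rewrite !big_ord_recr/= A'E /A' ltnn => ->; last first.
  move=> i ik; case: ifPn => [|ik']; first exact: GA.
  by have -> : i = k by lia.
have -> : P (\big[setI/setT]_(i < k) A i) = (\prod_(i < k) P (A i))%E by exact: Xind.
by congr (_ * _)%E; apply: eq_bigr => i _; rewrite ltn_ord.
Qed.

(** Despite its name this is only the generating pi-system; the joint sigma-algebra is obtained by
    applying [<<s _ >>]. *)
Definition joint_sigma I J K X Y Z :=
  setI3_class (gen_sigma I X) (gen_sigma J Y) (gen_sigma K Z).

Lemma joint_sigma_measurable I J K X Y Z :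
  (forall i, measurable_fun setT (X i)) -> (forall i, measurable_fun setT (Y i)) ->
  (forall i, measurable_fun setT (Z i)) -> joint_sigma I J K X Y Z `<=` measurable.
Proof.
by move=> mX mY mZ; apply: setI3_class_measurable; exact: gen_sigma_measurable.
Qed.

Lemma joint_sigmaT I J K X Y Z : joint_sigma I J K X Y Z setT.
Proof.
by exists setT, setT, setT; split; [exact: g_sigma_algebraT..|rewrite !setIT].
Qed.

(** On generators, regroup the six events by sequence: [indep3] splits off the sequences, the block
    hypotheses split each pair, and [indep3] reassembles the two triples. *)
Lemma indep3_joint_sigma I J K I' J' K' X Y Z :
  (forall i, measurable_fun setT (X i)) -> (forall i, measurable_fun setT (Y i)) ->
  (forall i, measurable_fun setT (Z i)) -> indep3 P X Y Z ->
  indep_sets P (gen_sigma I X) (gen_sigma I' X) ->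
  indep_sets P (gen_sigma J Y) (gen_sigma J' Y) ->
  indep_sets P (gen_sigma K Z) (gen_sigma K' Z) ->
  indep_sets P <<s joint_sigma I J K X Y Z >> <<s joint_sigma I' J' K' X Y Z >>.
Proof.
move=> mX mY mZ XYZ iX iY iZ; apply: indep_sets_sigma.
- exact: joint_sigma_measurable.
- exact: joint_sigma_measurable.
- by apply: setI3_class_setI; exact: g_sigma_algebraI.
- exact: joint_sigmaT.
- by apply: setI3_class_setI; exact: g_sigma_algebraI.
- exact: joint_sigmaT.
have sub (V : nat -> T -> R) L : gen_sigma L V `<=` gen_sigma setT V.
  by apply: sub_gen_sigma => i.
move=> _ _ [A [B [C [GA GB GC ->]]]] [A' [B' [C' [GA' GB' GC' ->]]]].
have sub2 (V : nat -> T -> R) L L' D D' : gen_sigma L V D -> gen_sigma L' V D' ->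
    gen_sigma setT V (D `&` D').
  by move=> /sub ? /sub ?; exact: g_sigma_algebraI.
rewrite (XYZ A B C (sub _ _ _ GA) (sub _ _ _ GB) (sub _ _ _ GC)).
rewrite (XYZ A' B' C' (sub _ _ _ GA') (sub _ _ _ GB') (sub _ _ _ GC')).
rewrite setIACA (setIACA A) XYZ; [|exact: sub2 GA GA'|exact: sub2 GB GB'|exact: sub2 GC GC'].
by rewrite iX// iY// iZ// [RHS]muleACA (muleACA (P A) (P B)).
Qed.

Lemma measurable_joint_sigma1 I J K X Y Z i : I i ->
  measurable_fun setT (X i : g_sigma_algebraType (joint_sigma I J K X Y Z) -> R).
Proof.
move=> Ii _ B mB; rewrite setTI; apply: sub_sigma_algebra.
apply: setI3_class_sub1; [exact: g_sigma_algebraT..|].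
exact: gen_sigma_preimage.
Qed.

Lemma measurable_joint_sigma2 I J K X Y Z i : J i ->
  measurable_fun setT (Y i : g_sigma_algebraType (joint_sigma I J K X Y Z) -> R).
Proof.
move=> Ii _ B mB; rewrite setTI; apply: sub_sigma_algebra.
apply: setI3_class_sub2; [exact: g_sigma_algebraT..|].
exact: gen_sigma_preimage.
Qed.

Lemma measurable_joint_sigma3 I J K X Y Z i : K i ->
  measurable_fun setT (Z i : g_sigma_algebraType (joint_sigma I J K X Y Z) -> R).
Proof.
move=> Ii _ B mB; rewrite setTI; apply: sub_sigma_algebra.
apply: setI3_class_sub3; [exact: g_sigma_algebraT..|].
exact: gen_sigma_preimage.
Qed.

End generated_sigma.

Lemma measurable_inv1D (d : measure_display) (T : measurableType d)
    (R : realType) (f : T -> R) : (forall t, 0 <= f t) ->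
  measurable_fun setT f -> measurable_fun setT (fun t => (1 + f t)^-1).
Proof.
(* The inverse is turned into a real power, to which [measurable_powR] applies; the two agree
   because [1 + f t] is nonnegative. *)
move=> f0 mf; have -> : (fun t => (1 + f t)^-1) = (fun t => (1 + f t) `^ (-1)).
  by apply/funext => t; rewrite powR_inv1// addr_ge0.
apply: (measurableT_comp (measurable_powR _)).
exact: measurable_funD.
Qed.

(** * Expectations depend only on the laws *)

Section identical_distribution.
Context {d : measure_display} {T : measurableType d} {R : realType}.
Context {P : probability T R}.
Local Open Scope ereal_scope.

Lemma ge0_integral_ident_distr (X : nat -> {RV P >-> R}) n (h : R -> \bar R) :
  ident_distr P (fun n => X n) -> measurable_fun setT h -> (forall x, 0 <= h x) ->
  \int[P]_t h (X n t) = \int[P]_t h (X 0%N t).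
Proof.
move=> Xid mh h0.
rewrite -(ge0_integral_distribution (X n))// -(ge0_integral_distribution (X 0%N))//.
by apply: eq_measure_integral => A mA _; exact: Xid.
Qed.

(** Independence within each pair makes the joint law a product, so the inner and then the outer
    marginal can be replaced in the iterated integral. *)
Lemma ge0_integral_ident_distr2 (X Y : nat -> {RV P >-> R}) n (h : R * R -> \bar R) :
  ident_distr P (fun n => X n) -> ident_distr P (fun n => Y n) ->
  (forall k (A B : set R), measurable A -> measurable B ->
    P (X k @^-1` A `&` Y k @^-1` B) = P (X k @^-1` A) * P (Y k @^-1` B)) ->
  measurable_fun setT h -> (forall z, 0 <= h z) ->
  \int[P]_t h (X n t, Y n t) = \int[P]_t h (X 0%N t, Y 0%N t).
Proof.
move=> Xid Yid XY mh h0.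
rewrite (ge0_integral_indep P _ _ _ _ (X n) (Y n) h (XY n) mh h0).
rewrite (ge0_integral_indep P _ _ _ _ (X 0%N) (Y 0%N) h (XY 0%N) mh h0).
transitivity (\int[distribution P (X n)]_x \int[distribution P (Y 0%N)]_y h (x, y)).
  apply: eq_integral => x _; apply: eq_measure_integral => A mA _; exact: Yid.
by apply: eq_measure_integral => A mA _; exact: Xid.
Qed.

End identical_distribution.

(** * Discounted losses along residue classes and the ruin bound *)

Section risk_model.
Context {d : measure_display} {T : measurableType d} {R : realType}.
Context {P : probability T R} {m : nat} {X Y I : nat -> {RV P >-> R}}.
Hypothesis hI0 : forall n t, 0 <= I n t.
Hypothesis hXid : ident_distr P (fun n => X n).
Hypothesis hYid : ident_distr P (fun n => Y n).
Hypothesis hIid : ident_distr P (fun n => I n).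
Hypothesis hXdep : m_dependent P m (fun n => X n).
Hypothesis hYdep : m_dependent P m (fun n => Y n).
Hypothesis hIind : mutually_indep P (fun n => I n).
Hypothesis hind : indep3 P (fun n => X n) (fun n => Y n) (fun n => I n).

Definition disc n t : R := \prod_(j < n) (1 + I j t)^-1.

Definition loss n t : R := Y n t / (1 + I n t) - X n t.

(** All classes run on the common clock [n]: off-class terms are zero, so each process moves only
    after its own indices and the [m.+1] processes add up to the total loss. *)
Definition class_loss r n t : R :=
  \sum_(i < n) if (i %% m.+1 == r)%N then disc i t * loss i t else 0.

Lemma disc_ge0_le1 n t : 0 <= disc n t <= 1.
Proof.
rewrite /disc; apply/andP; split.
  by apply: prodr_ge0 => i _; rewrite invr_ge0 addr_ge0.
apply: (@le_trans _ _ (\prod_(j < n) 1)); last by rewrite big1.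
apply: ler_prod => i _; rewrite invr_ge0 addr_ge0//=.
by rewrite invf_le1 ?ltr_pwDl// lerDl.
Qed.

(** Multiplying the recursion by [disc n.+1] cancels the factor [1 + I n]: the premium enters with
    weight [disc n], and only the claim keeps the extra division by [1 + I n]. *)
Lemma surplus_disc u n t :
  surplus (fun n => X n) (fun n => Y n) (fun n => I n) u n t * disc n t =
  u - \sum_(i < n) disc i t * loss i t.
Proof.
elim: n => [|n IH]; first by rewrite /disc !big_ord0 mulr1 subr0.
have Dn : disc n.+1 t = disc n t * (1 + I n t)^-1 by rewrite /disc big_ord_recr.
have I0 : 1 + I n t != 0 by rewrite lt0r_neq0// ltr_pwDl.
rewrite big_ord_recr/= opprD addrA -IH Dn /loss.
by field.
Qed.

Lemma sum_class_loss n t :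
  \sum_(r < m.+1) class_loss r n t = \sum_(i < n) disc i t * loss i t.
Proof.
rewrite /class_loss exchange_big/=; apply: eq_bigr => i _.
have im : (i %% m.+1 < m.+1)%N by rewrite ltn_mod.
rewrite (bigD1 (Ordinal im))//= eqxx big1 ?addr0// => r ri.
by rewrite ifN// eq_sym.
Qed.

(** Pigeonhole: if every class sum were at most [u / m.+1%:R], the total would be at most [u] and
    the discounted surplus nonnegative, while [disc n t > 0] preserves the sign. *)
Lemma ruin_class_loss u t n :
  surplus (fun n => X n) (fun n => Y n) (fun n => I n) u n t < 0 ->
  exists2 r, (r < m.+1)%N & u / m.+1%:R < class_loss r n t.
Proof.
move=> U0; apply/not_exists2P => H.
have : surplus (fun n => X n) (fun n => Y n) (fun n => I n) u n t * disc n t < 0.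
  rewrite pmulr_llt0// /disc; apply: prodr_gt0 => i _.
  by rewrite invr_gt0 ltr_pwDl.
rewrite surplus_disc -sum_class_loss subr_lt0 ltNge => /negP; apply.
have -> : u = \sum_(r < m.+1) u / m.+1%:R.
  by rewrite sumr_const card_ord -[RHS]mulr_natr divfK// pnatr_eq0.
apply: ler_sum => r _; rewrite leNgt; apply/negP => ur.
by have [] := H r; case.
Qed.

(** Premiums and claims need the gap imposed by m-dependence, whereas the independent rates may run
    up to [k - 1], as [disc k] requires. *)
Let past k := joint_sigma [set i | (i + m < k)%N] [set i | (i + m < k)%N]
  [set i | (i < k)%N] (fun n => X n) (fun n => Y n) (fun n => I n).

Let present k := joint_sigma [set k] [set k] [set k]
  (fun n => X n) (fun n => Y n) (fun n => I n).

Let past_present k : indep_sets P <<s past k >> <<s present k >>.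
Proof.
apply: indep3_joint_sigma => //; [exact: m_dependent_past..|].
exact: mutually_indep_past.
Qed.

(** The abstract domain [T'] allows use both on [T] and on the sub-sigma-algebras [past k]. *)
Let measurable_disc (d' : measure_display) (T' : measurableType d') n
    (J : nat -> T' -> R) : (forall i t, 0 <= J i t) ->
  (forall i, (i < n)%N -> measurable_fun setT (J i)) ->
  measurable_fun setT (fun t => \prod_(j < n) (1 + J j t)^-1).
Proof.
by move=> J0 mJ; apply: measurable_prod => j _; exact/measurable_inv1D/mJ.
Qed.

Let measurable_loss (d' : measure_display) (T' : measurableType d')
    (x y i : T' -> R) : (forall t, 0 <= i t) ->
  measurable_fun setT x -> measurable_fun setT y -> measurable_fun setT i ->
  measurable_fun setT (fun t => y t / (1 + i t) - x t).
Proof.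
move=> i0 mx my mi; apply: measurable_funB => //; apply: measurable_funM => //.
exact: measurable_inv1D.
Qed.

(** This is the purpose of the residue classes: at an index [k] of class [r], the earlier nonzero
    terms are old enough to be independent of the present. *)
Lemma measurable_class_loss_past r k j : (k %% m.+1 == r)%N -> (j <= k)%N ->
  measurable_fun setT (class_loss r j : g_sigma_algebraType (past k) -> R).
Proof.
move=> kr; elim: j => [_|j IH jk].
  have -> : class_loss r 0 = cst 0 by apply/funext => t; rewrite /class_loss big_ord0.
  exact: measurable_cst.
have -> : class_loss r j.+1 = (fun t => class_loss r j t +
    if (j %% m.+1 == r)%N then disc j t * loss j t else 0).
  by apply/funext => t; rewrite /class_loss big_ord_recr.
apply: measurable_funD; first by apply: IH; exact: ltnW.
case: (boolP (j %% m.+1 == r)%N) => [jr|_]; last exact: measurable_cst.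
(* two indices of the same residue class are at distance at least [m.+1] *)
have jmk : (j + m < k)%N.
  rewrite ltnNge; apply/negP => kjm.
  have : (k - j = 0 %[mod m.+1])%N.
    apply/eqP; rewrite -(eqn_modDl j) subnKC ?(ltnW jk)// addn0.
    by rewrite (eqP kr) (eqP jr).
  by rewrite mod0n modn_small; lia.
apply: measurable_funM.
  apply: (@measurable_disc _ (g_sigma_algebraType (past k)) j (fun n => I n)) => //.
  move=> i ij; apply: measurable_joint_sigma3 => /=; lia.
apply: (@measurable_loss _ (g_sigma_algebraType (past k))) => //.
- exact: measurable_joint_sigma1.
- exact: measurable_joint_sigma2.
- by apply: measurable_joint_sigma3 => /=; lia.
Qed.

Let measurable_class_loss r n : measurable_fun setT (class_loss r n).
Proof.
elim: n => [|n IH].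
  have -> : class_loss r 0 = cst 0 by apply/funext => t; rewrite /class_loss big_ord0.
  exact: measurable_cst.
have -> : class_loss r n.+1 = (fun t => class_loss r n t +
    if (n %% m.+1 == r)%N then disc n t * loss n t else 0).
  by apply/funext => t; rewrite /class_loss big_ord_recr.
apply: measurable_funD => //.
case: (boolP (n %% m.+1 == r)%N) => [_|_]; last exact: measurable_cst.
apply: measurable_funM; first exact: (@measurable_disc _ _ n (fun n => I n)).
exact: measurable_loss.
Qed.

Let indep_pair k (A B : set R) : measurable A -> measurable B ->
  P (Y k @^-1` A `&` I k @^-1` B) = (P (Y k @^-1` A) * P (I k @^-1` B))%E.
Proof.
move=> mA mB; rewrite -[LHS]/(P (_ `&` _)) -(setTI (Y k @^-1` A)).
rewrite hind.
- by rewrite probability_setT mul1e setTI.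
- exact: g_sigma_algebraT.
- exact: (gen_sigma_preimage (fun n => Y n)).
- exact: (gen_sigma_preimage (fun n => I n)).
Qed.

(** Carries the exponential moment condition from index 0 to every [k]: [X k] is independent of
    [(Y k, I k)], so the integral factors into terms determined by the marginal laws. *)
Lemma integral_expR_loss (c : R) k :
  (\int[P]_t (expR (c * loss k t))%:E = \int[P]_t (expR (c * loss 0 t))%:E)%E.
Proof.
pose h (z : R * R) : \bar R := (expR (c * (z.1 * (1 + z.2) `^ (-1))))%:E.
pose hX (x : R) : \bar R := (expR (- (c * x)))%:E.
have mh : measurable_fun setT h.
  apply/measurable_EFinP; apply: measurableT_comp => //.
  apply: measurable_funM => //; apply: measurable_funM => //.
  apply: (measurableT_comp (measurable_powR _)).
  exact: measurable_funD.
have mhX : measurable_fun setT hX.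
  apply/measurable_EFinP; apply: measurableT_comp => //.
  by apply: measurable_funN; exact: measurable_funM.
have E n : (\int[P]_t (expR (c * loss n t))%:E =
    (\int[P]_t hX (X n t)) * (\int[P]_t h (Y n t, I n t)))%E.
  transitivity (\int[P]_t (expR (- (c * X n t)) *
      expR (c * (Y n t * (1 + I n t) `^ (-1))))%:E)%E.
    apply: eq_integral => t _; congr (_%:E); rewrite -expRD powR_inv1 ?addr_ge0//.
    by congr expR; rewrite /loss; ring.
  (* Each sequence has an empty block in [F] or in [G], so blockwise independence is trivial and
     [indep3] does the rest. *)
  pose F := joint_sigma [set n] set0 set0 (fun n => X n) (fun n => Y n) (fun n => I n).
  pose G := joint_sigma set0 [set n] [set n] (fun n => X n) (fun n => Y n) (fun n => I n).
  apply: (@ge0_integral_indepM _ _ _ P F G).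
  - exact: joint_sigma_measurable.
  - exact: joint_sigma_measurable.
  - apply: indep3_joint_sigma => //.
    + exact/indep_setsC/indep_sets_gen_sigma_set0.
    + exact: indep_sets_gen_sigma_set0.
    + exact: indep_sets_gen_sigma_set0.
  - apply: measurableT_comp => //; apply: measurable_funN.
    by apply: measurable_funM => //; exact: measurable_joint_sigma1.
  - apply: measurableT_comp => //; apply: measurable_funM => //.
    apply: measurable_funM; first exact: measurable_joint_sigma2.
    apply: (measurableT_comp (measurable_powR _)).
    by apply: measurable_funD => //; exact: measurable_joint_sigma3.
  - by move=> t; exact: expR_ge0.
  - by move=> t; exact: expR_ge0.
have EX : (\int[P]_t hX (X k t) = \int[P]_t hX (X 0%N t))%E.
  by apply: ge0_integral_ident_distr => // x; rewrite lee_fin expR_ge0.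
have EYI : (\int[P]_t h (Y k t, I k t) = \int[P]_t h (Y 0%N t, I 0%N t))%E.
  by apply: ge0_integral_ident_distr2 => // z; rewrite lee_fin expR_ge0.
apply: etrans (E k) _; apply: etrans _ (esym (E 0%N)).
by rewrite EX EYI.
Qed.

Lemma class_loss_maximal (c v : R) r : 0 <= c -> 0 <= v ->
  (\int[P]_t (expR (c * loss 0 t))%:E <= 1)%E ->
  (P (\bigcup_n [set t | (v < class_loss r n t)%R]) <= (expR (- (c * v)))%:E)%E.
Proof.
move=> c0 v0 Ec; apply: maximal_inequality => //.
  by move=> t; rewrite /class_loss big_ord0.
move=> n.
have WS t : class_loss r n.+1 t = class_loss r n t +
    if (n %% m.+1 == r)%N then disc n t * loss n t else 0.
  by rewrite /class_loss big_ord_recr.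
(* At an off-class index the process stands still, and the two integrals coincide. *)
have [nr|nr] := boolP (n %% m.+1 == r)%N; last first.
  by under eq_integral do rewrite WS (negbTE nr) addr0.
(* The constant [c] is moved next to [loss n t], leaving [disc n t], which lies in [0, 1], as the
   convexity weight. *)
under eq_integral do rewrite WS nr mulrDr (mulrCA c) expRD (mulrA (\1_ _ _)).
have mW j : (j <= n)%N ->
    measurable_fun setT (class_loss r j : g_sigma_algebraType (past n) -> R).
  exact: measurable_class_loss_past.
apply: (@integral_expR_step _ _ _ P (past n) (present n) _ (disc n)
  (fun t => c * loss n t)) => //.
- exact: joint_sigma_measurable.
- exact: joint_sigma_measurable.
- apply: measurable_funM.
    apply: measurable_indic.
    exact: (@measurable_below _ (g_sigma_algebraType (past n))).
  apply: measurableT_comp => //; apply: measurable_funM => //.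
  exact: mW.
- apply: (@measurable_disc _ (g_sigma_algebraType (past n)) n (fun n => I n)) => //.
  by move=> i ij; apply: measurable_joint_sigma3.
- apply: measurable_funM => //.
  apply: (@measurable_loss _ (g_sigma_algebraType (present n))) => //.
  + exact: measurable_joint_sigma1.
  + exact: measurable_joint_sigma2.
  + exact: measurable_joint_sigma3.
- by move=> t; exact: disc_ge0_le1.
- by rewrite integral_expR_loss.
Qed.

Lemma measurable_surplus u n : measurable_fun setT
  (surplus (fun n => X n) (fun n => Y n) (fun n => I n) u n).
Proof.
elim: n => [|n IH] /=; first exact: measurable_cst.
apply: measurable_funB => //; apply: measurable_funM; first exact: measurable_funD.
exact: measurable_funD.
Qed.

(** The union bound over the residue classes produces the factor [m.+1%:R]. *)
Lemma ruin_prob_le (c u : R) : 0 <= c -> 0 <= u ->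
  (\int[P]_t (expR (c * loss 0 t))%:E <= 1)%E ->
  (ruin_prob P (fun n => X n) (fun n => Y n) (fun n => I n) u
    <= (m.+1%:R * expR (- (c * (u / m.+1%:R))))%:E)%E.
Proof.
move=> c0 u0 Ec; pose v := u / m.+1%:R.
have v0 : 0 <= v by rewrite divr_ge0.
have mlt (f : T -> R) (x : R) : measurable_fun setT f -> measurable [set t | x < f t].
  move=> mf; have -> : [set t | x < f t] = ~` [set t | f t <= x].
    by apply/seteqP; split => t /=; rewrite ltNge => /negP.
  exact/measurableC/measurable_sublevel.
pose C r := \bigcup_n [set t | v < class_loss r n t].
have mC r : measurable (C r) by apply: bigcup_measurable => n _; exact: mlt.
have sub : \bigcup_n [set t | surplus (fun n => X n) (fun n => Y n)
    (fun n => I n) u n.+1 t < 0] `<=` \big[setU/set0]_(r < m.+1) C r.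
  move=> t [n _ U0]; have [r rm vr] := ruin_class_loss u t n.+1 U0.
  by rewrite -bigcup_mkord; exists r => //; exists n.+1.
apply: (@le_trans _ _ (P (\big[setU/set0]_(r < m.+1) C r))).
  apply: le_measure => //; rewrite inE.
    apply: bigcup_measurable => n _.
    have -> : [set t | surplus (fun n => X n) (fun n => Y n) (fun n => I n) u n.+1 t < 0]
      = [set t | 0 < - surplus (fun n => X n) (fun n => Y n) (fun n => I n) u n.+1 t].
      by apply/seteqP; split => t /=; rewrite oppr_gt0.
    by apply: mlt; apply: measurable_funN; exact: measurable_surplus.
  by apply: bigsetU_measurable.
apply: (@le_trans _ _ (\sum_(r < m.+1) P (C r))%E); first exact: Boole_inequality.
apply: (@le_trans _ _ (\sum_(r < m.+1) (expR (- (c * v)))%:E)%E).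
  by apply: lee_sum => r _; exact: class_loss_maximal.
by rewrite sumEFin lee_fin sumr_const card_ord mulr_natl.
Qed.

End risk_model.

Theorem theorem3p1 (d : measure_display) (T : measurableType d) (R : realType)
  (P : probability T R) (m : nat)
  (X Y I : nat -> {RV P >-> R})
  (hX0 : forall n t, 0 <= X n t) (hY0 : forall n t, 0 <= Y n t)
  (hI0 : forall n t, 0 <= I n t)
  (hXint : forall n, P.-integrable setT (EFin \o X n))
  (hYint : forall n, P.-integrable setT (EFin \o Y n))
  (hIint : forall n, P.-integrable setT (EFin \o I n))
  (hXid : ident_distr P (fun n => X n)) (hYid : ident_distr P (fun n => Y n))
  (hIid : ident_distr P (fun n => I n))
  (hXdep : m_dependent P m (fun n => X n))
  (hYdep : m_dependent P m (fun n => Y n))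
  (hIind : mutually_indep P (fun n => I n))
  (hind : indep3 P (fun n => X n) (fun n => Y n) (fun n => I n))
  (Rc : R) (hR : 0 < Rc)
  (hLund : (\int[P]_t (expR (Rc * (Y 0%N t / (1 + I 0%N t) - X 0%N t)))%:E
            <= 1)%E) :
  forall u : R, (m.+1)%:R * ln (m.+1)%:R / Rc < u ->
    (ruin_prob P (fun n => X n) (fun n => Y n) (fun n => I n) u
      <= ((m.+1)%:R * expR (- Rc * u / (m.+1)%:R))%:E)%E.
Proof.
move=> u hu.
(* The threshold is the point beyond which the bound is less than 1; it is nonnegative because
   [m.+1] is at least 1. *)
have u0 : 0 <= u.
  apply: le_trans (ltW hu); rewrite divr_ge0 ?(ltW hR)// mulr_ge0//.
  by rewrite ln_ge0// ler1n.
rewrite mulNr mulNr -mulrA.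
exact: (ruin_prob_le hI0 hXid hYid hIid hXdep hYdep hIind hind Rc u (ltW hR) u0 hLund).
Qed.
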